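(* Every representable clustering scheme is excisive and functorial. Every excisive and functorial clustering scheme $\mathfrak c$ is refined by some representable clustering scheme $\mathfrak c'$; in particular $\mathfrak c$ is naturally isomorphic, as a functor $\mathcal G\to\mathcal P$, to a representable clustering scheme.
   Context: A hypergraph is a triple $G=(V,E,\epsilon)$, where $V$ is a finite vertex set, $E$ is a finite edge set disjoint from $V$, and $\epsilon:E\to2^V$ gives edge vertex sets. Distinct edges may have the same vertex set. A morphism $H\to G$ is an injective map $f:V(H)\to V(G)$ such that for every edge $e$ of $H$ there is an edge $e'$ of $G$ with $f(\epsilon_H(e))=\epsilon_G(e')$. This gives the category $\mathcal G$, with $\hom(H,G)$ the set of morphisms. For $p\subseteq V$, the restriction $G|_p$ has vertex set $p$ and those edges $e$ with $\epsilon(e)\subseteq p$. $\mathcal P$ is the category with objects $(V,P)$, where $V$ is a finite set and $P\subseteq2^V$ is a set of parts (not necessarily disjoint or covering, possibly empty). Morphisms $(V,P)\to(W,Q)$ are functions $f:V\to W$ such that each $p\in P$ has some $q\in Q$ with $f(p)\subseteq q$. A clustering scheme $\mathfrak c$ assigns to each hypergraph $G$ an object $(V(G),P)$ of $\mathcal P$ with the same underlying set. It is functorial if every morphism $f:G\to H$ is also a morphism $\mathfrak c(G)\to\mathfrak c(H)$ in $\mathcal P$, making $\mathfrak c$ a functor that is the identity on underlying functions. It is excisive if for every $G$ and every part $p$ of $\mathfrak c(G)$, $p$ is a part of $\mathfrak c(G|_p)$. A clustering scheme $\mathfrak c_1$ refines $\mathfrak c_2$ if for every $G$: every part of $\mathfrak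 c_1(G)$ is contained in some part of $\mathfrak c_2(G)$, and every part of $\mathfrak c_2(G)$ is a part of $\mathfrak c_1(G)$. For a (possibly infinite) set $\mathfrak R$ of hypergraphs, $\Phi_{\mathfrak R}(G)$ has vertex set $V(G)$ and edge set $\bigcup_{R\in\mathfrak R}\hom(R,G)$ (disjoint union), where the edge $\omega\in\hom(R,G)$ has vertex set $\omega(V(R))$. For $k\in\mathbb N\cup\{\infty\}$ with $k\ge1$, the $k$-line graph $\Lambda_k(G)$ is the simple graph with vertex set $\{\epsilon(e):e\in E\}$ in which distinct $u,v$ are adjacent iff $|u\cap v|\ge k$ (no edges if $k=\infty$). $\Pi_k(G)=(V(G),P)$, where $P$ consists of the sets $\bigcup_{x\in C}x$ for $C$ ranging over the vertex sets of connected components (including singletons) of $\Lambda_k(G)$. A clustering scheme is representable if it equals $\Pi_{\mathfrak R,k}:=\Pi_k\circ\Phi_{\mathfrak R}$ for some set $\mathfrak R$ of hypergraphs and some $k\in\mathbb N\cup\{\infty\}$, $k\ge1$. *)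

(* Defs.v *)
From mathcomp Require Import all_boot.
From mathcomp Require Import boolp.

Set Implicit Arguments.
Unset Strict Implicit.
Unset Printing Implicit Defensive.

Record category := Category {
  obj : Type;
  arr : obj -> obj -> Type;
  idarr : forall A, arr A A;
  (* diagrammatic order: [comparr f g] is f followed by g *)
  comparr : forall A B C, arr A B -> arr B C -> arr A C;
  comp_idl : forall A B (f : arr A B), comparr (idarr A) f = f;
  comp_idr : forall A B (f : arr A B), comparr f (idarr B) = f;
  comp_assoc : forall A B C D (f : arr A B) (g : arr B C) (h : arr C D),
    comparr f (comparr g h) = comparr (comparr f g) h
}.

Record functor (C D : category) := Functor {
  fobj : obj C -> obj D;
  fmap : forall A B : obj C, arr A B -> arr (fobj A) (fobj B);
  fmap_id : forall A : obj C, fmap (idarr A) = idarr (fobj A);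
  fmap_comp : forall (A B E : obj C) (f : arr A B) (g : arr B E),
    fmap (comparr f g) = comparr (fmap f) (fmap g)
}.

Definition is_iso (C : category) (A B : obj C) (f : arr A B) : Prop :=
  exists g : arr B A, comparr f g = idarr A /\ comparr g f = idarr B.

Definition naturally_isomorphic (C D : category) (F F' : functor C D) : Prop :=
  exists eta : forall A : obj C, arr (fobj F A) (fobj F' A),
    (forall (A B : obj C) (f : arr A B),
       comparr (fmap F f) (eta B) = comparr (eta A) (fmap F' f)) /\
    (forall A : obj C, is_iso (eta A)).

Record hypergraph := Hypergraph {
  vert : finType;
  edge : finType;
  eps : edge -> {set vert}
}.

Definition is_ghom (H G : hypergraph) (f : {ffun vert H -> vert G}) : bool :=
  injectiveb f && [forall e : edge H, exists e' : edge G, f @: eps e == eps e'].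

Definition ghom (H G : hypergraph) : Type :=
  {f : {ffun vert H -> vert G} | is_ghom f}.

Lemma is_ghom_id (G : hypergraph) : is_ghom ([ffun x => x] : {ffun vert G -> _}).
Proof.
apply/andP; split; first by apply/injectiveP => x y; rewrite !ffunE.
apply/forallP => e; apply/existsP; exists e; apply/eqP.
by rewrite -[RHS]imset_id; apply: eq_imset => x; rewrite ffunE.
Qed.

Lemma is_ghom_comp (A B C : hypergraph) (f : ghom A B) (g : ghom B C) :
  is_ghom [ffun x => val g (val f x)].
Proof.
have /andP[/injectiveP fI /forallP fE] := valP f.
have /andP[/injectiveP gI /forallP gE] := valP g.
apply/andP; split; first by apply/injectiveP => x y; rewrite !ffunE => /gI/fI.
apply/forallP => e; apply/existsP.
have /existsP[e' /eqP fe] := fE e; have /existsP[e'' /eqP ge] := gE e'.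
exists e''; apply/eqP; rewrite -ge -fe -imset_comp.
by apply: eq_imset => x; rewrite ffunE.
Qed.

Definition ghom_id (G : hypergraph) : ghom G G :=
  exist _ [ffun x => x] (is_ghom_id G).

Definition ghom_comp (A B C : hypergraph) (f : ghom A B) (g : ghom B C) :
  ghom A C := exist _ [ffun x => val g (val f x)] (is_ghom_comp f g).

Lemma ghom_comp_idl A B (f : ghom A B) : ghom_comp (ghom_id A) f = f.
Proof. by apply: val_inj; apply/ffunP => x; rewrite !ffunE. Qed.

Lemma ghom_comp_idr A B (f : ghom A B) : ghom_comp f (ghom_id B) = f.
Proof. by apply: val_inj; apply/ffunP => x; rewrite !ffunE. Qed.

Lemma ghom_comp_assoc A B C D (f : ghom A B) (g : ghom B C) (h : ghom C D) :
  ghom_comp f (ghom_comp g h) = ghom_comp (ghom_comp f g) h.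
Proof. by apply: val_inj; apply/ffunP => x; rewrite !ffunE. Qed.

Definition catG : category :=
  Category ghom_comp_idl ghom_comp_idr ghom_comp_assoc.

(* The restriction G|_p: its vertex type is the subtype p, and [eps e], being
   included in p, is transported to that subtype by preimage. *)
Definition restrict (G : hypergraph) (p : {set vert G}) : hypergraph :=
  @Hypergraph {x : vert G | x \in p} {e : edge G | eps e \subset p}
    (fun e => [set x | val x \in eps (val e)]).

Record partset := PartSet {
  pvert : finType;
  parts : {set {set pvert}}
}.

Definition is_phom (A B : partset) (f : {ffun pvert A -> pvert B}) : bool :=
  [forall p in parts A, exists q in parts B, f @: p \subset q].

Definition phom (A B : partset) : Type :=
  {f : {ffun pvert A -> pvert B} | is_phom f}.

Lemma is_phom_id (A : partset) : is_phom ([ffun x => x] : {ffun pvert A -> _}).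
Proof.
apply/forall_inP => p Pp; apply/exists_inP; exists p => //.
by apply/subsetP => _ /imsetP[y yp ->]; rewrite ffunE.
Qed.

Lemma is_phom_comp (A B C : partset) (f : phom A B) (g : phom B C) :
  is_phom [ffun x => val g (val f x)].
Proof.
have /forall_inP fP := valP f; have /forall_inP gP := valP g.
apply/forall_inP => p /fP/exists_inP[q /gP/exists_inP[r Pr gq] fp].
apply/exists_inP; exists r => //; apply: subset_trans gq.
apply/subsetP => _ /imsetP[y yp ->]; rewrite ffunE.
by apply: imset_f; apply: (subsetP fp); apply: imset_f.
Qed.

Definition phom_id (A : partset) : phom A A := exist _ [ffun x => x] (is_phom_id A).

Definition phom_comp (A B C : partset) (f : phom A B) (g : phom B C) :
  phom A C := exist _ [ffun x => val g (val f x)] (is_phom_comp f g).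

Lemma phom_comp_idl A B (f : phom A B) : phom_comp (phom_id A) f = f.
Proof. by apply: val_inj; apply/ffunP => x; rewrite !ffunE. Qed.

Lemma phom_comp_idr A B (f : phom A B) : phom_comp f (phom_id B) = f.
Proof. by apply: val_inj; apply/ffunP => x; rewrite !ffunE. Qed.

Lemma phom_comp_assoc A B C D (f : phom A B) (g : phom B C) (h : phom C D) :
  phom_comp f (phom_comp g h) = phom_comp (phom_comp f g) h.
Proof. by apply: val_inj; apply/ffunP => x; rewrite !ffunE. Qed.

Definition catP : category :=
  Category phom_comp_idl phom_comp_idr phom_comp_assoc.

(* The underlying set of the object assigned to G is V(G) by construction, so a
   scheme is given by the set of parts alone. *)
Definition clustering_scheme : Type :=
  forall G : hypergraph, {set {set vert G}}.

Definition scheme_obj (c : clustering_scheme) (G : hypergraph) : partset :=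
  PartSet (c G).

Definition functorial (c : clustering_scheme) : Prop :=
  forall (G H : hypergraph) (f : ghom G H),
    @is_phom (scheme_obj c G) (scheme_obj c H) (val f).

Definition scheme_map (c : clustering_scheme) (fc : functorial c)
    (G H : hypergraph) (f : ghom G H) : phom (scheme_obj c G) (scheme_obj c H) :=
  exist _ (val f) (fc G H f).

Lemma scheme_map_id (c : clustering_scheme) (fc : functorial c) G :
  scheme_map fc (ghom_id G) = phom_id (scheme_obj c G).
Proof. exact: val_inj. Qed.

Lemma scheme_map_comp (c : clustering_scheme) (fc : functorial c) G H K
    (f : ghom G H) (g : ghom H K) :
  scheme_map fc (ghom_comp f g) = phom_comp (scheme_map fc f) (scheme_map fc g).
Proof. exact: val_inj. Qed.

Definition scheme_functor (c : clustering_scheme) (fc : functorial c) :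
    functor catG catP :=
  @Functor catG catP (scheme_obj c) (scheme_map fc)
    (scheme_map_id fc) (scheme_map_comp fc).

(* As a set of vertices of G|_p, the part p is the full set. *)
Definition excisive (c : clustering_scheme) : Prop :=
  forall (G : hypergraph) (p : {set vert G}),
    p \in c G -> [set: vert (restrict p)] \in c (restrict p).

Definition refines (c1 c2 : clustering_scheme) : Prop :=
  forall G : hypergraph,
    (forall p, p \in c1 G -> exists2 q, q \in c2 G & p \subset q) /\
    c2 G \subset c1 G.

(* Hypergraphs on a finite vertex set whose edges may form an arbitrary type:
   for an infinite set RR of hypergraphs, the disjoint union of the
   hom(R, G) over R in RR may be infinite. *)
Record pre_hypergraph := PreHypergraph {
  pre_vert : finType;
  pre_edge : Type;
  pre_eps : pre_edge -> {set pre_vert}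
}.

Definition pre_of_hypergraph (G : hypergraph) : pre_hypergraph :=
  PreHypergraph (@eps G).
Coercion pre_of_hypergraph : hypergraph >-> pre_hypergraph.

Definition Phi (RR : hypergraph -> Prop) (G : hypergraph) : pre_hypergraph :=
  @PreHypergraph (vert G) {R : {R : hypergraph | RR R} & ghom (sval R) G}
    (fun w => val (projT2 w) @: [set: vert (sval (projT1 w))]).

(* Elements of {1, 2, ...} together with infinity are encoded as
   k : option nat with [k_ge1 k], where None is infinity. *)
Definition k_ge1 (k : option nat) : bool :=
  if k is Some n then 0 < n else true.

Definition k_le (k : option nat) (m : nat) : bool :=
  if k is Some n then n <= m else false.

Definition line_vert (G : pre_hypergraph) : {set {set pre_vert G}} :=
  [set x | `[< exists e : pre_edge G, pre_eps e = x >]].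

(* Adjacency in the k-line graph, extended by no edges to the subsets of V(G)
   which are not vertices of that graph. *)
Definition line_adj (k : option nat) (G : pre_hypergraph) :
    rel {set pre_vert G} :=
  fun u v => [&& u \in line_vert G, v \in line_vert G, u != v
               & k_le k #|u :&: v|].

Definition line_components (k : option nat) (G : pre_hypergraph) :
    {set {set {set pre_vert G}}} :=
  equivalence_partition (connect (@line_adj k G)) (line_vert G).

Definition Pi (k : option nat) (G : pre_hypergraph) : partset :=
  @PartSet (pre_vert G) [set cover C | C in line_components k G].

Definition repr_scheme (RR : hypergraph -> Prop) (k : option nat) :
    clustering_scheme :=
  fun G => parts (Pi k (Phi RR G)).

Definition representable (c : clustering_scheme) : Prop :=
  exists (RR : hypergraph -> Prop) (k : option nat),
    k_ge1 k /\ forall G : hypergraph, c G = repr_scheme RR k G.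

(* Main.v *)
(** A vertex injection preserves intersection cardinalities, so it maps paths of
    line graphs to paths: this gives functoriality of a representable scheme.
    A part of [repr_scheme RR k G] is a union of images of hypergraphs of [RR],
    all of which, as well as a path linking any two of them, survive in the
    restriction to the part: this gives excision.

    Conversely, given [c] excisive and functorial, take [k] infinite and for
    [RR] the hypergraphs [R] whose whole vertex set is a part of [c R]. The
    parts of the represented scheme are then the images of the morphisms from
    [RR]; each lies in a part of [c G] by functoriality, and each part [p] of
    [c G] is the image of the inclusion of the restriction to [p]. *)
From mathcomp Require Import all_boot.
From mathcomp Require Import boolp.
Require Import Defs.

Set Implicit Arguments.
Unset Strict Implicit.
Unset Printing Implicit Defensive.

(** Adjacency has to be preserved only at points reachable from [u]. Excision needs this weaker
    hypothesis: taking preimages in a restriction is well behaved only on sets contained in the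
    part. *)
Lemma connect_homo_from (T T' : finType) (e : rel T) (e' : rel T')
    (f : T -> T') (u v : T) :
  (forall x y, connect e u x -> e x y -> e' (f x) (f y)) ->
  connect e u v -> connect e' (f u) (f v).
Proof.
move=> ee' /connectP[s es ->].
elim/last_ind: s es => [|s x IHs]; first by rewrite connect0.
rewrite rcons_path last_rcons => /andP[us ex].
apply: connect_trans (IHs us) _; apply/connect1/ee' => //.
by apply/connectP; exists s.
Qed.

Lemma line_vert_PhiP (RR : hypergraph -> Prop) (G : hypergraph)
    (u : {set vert G}) :
  reflect (exists R : hypergraph, RR R /\
             exists w : ghom R G, u = val w @: [set: vert R])
          (u \in line_vert (Phi RR G)).
Proof.
rewrite inE; apply: (iffP (asboolP _)) => [[[[R RRR] w] /= <-]|[R [RRR [w ->]]]].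
  by exists R; split=> //; exists w.
by exists (existT _ (exist _ R RRR) w).
Qed.

Lemma repr_schemeP (RR : hypergraph -> Prop) (k : option nat) (G : hypergraph)
    (p : {set vert G}) :
  reflect (exists2 u, u \in line_vert (Phi RR G) &
             p = cover [set v in line_vert (Phi RR G)
                         | connect (@line_adj k (Phi RR G)) u v])
          (p \in repr_scheme RR k G).
Proof.
apply: (iffP imsetP) => [[_ /imsetP[u Lu ->] ->]|[u Lu ->]]; first by exists u.
by eexists; first by apply: imset_f; exact: Lu.
Qed.

Lemma ghom_inj (G H : hypergraph) (f : ghom G H) : injective (val f).
Proof. by have /andP[/injectiveP] := valP f. Qed.

Lemma imset_line_vert (RR : hypergraph -> Prop) (G H : hypergraph)
    (f : ghom G H) (u : {set vert G}) :
  u \in line_vert (Phi RR G) -> val f @: u \in line_vert (Phi RR H).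
Proof.
case/line_vert_PhiP => R [RRR [w ->]]; apply/line_vert_PhiP.
exists R; split=> //; exists (ghom_comp w f); rewrite -imset_comp.
by apply: eq_imset => x; rewrite /= ffunE.
Qed.

Lemma repr_scheme_functorial (RR : hypergraph -> Prop) (k : option nat) :
  functorial (repr_scheme RR k).
Proof.
move=> G H f; apply/forall_inP => _ /repr_schemeP[u Lu ->].
apply/exists_inP.
exists (cover [set v in line_vert (Phi RR H)
               | connect (@line_adj k (Phi RR H)) (val f @: u) v]).
  by apply/repr_schemeP; exists (val f @: u); first exact: imset_line_vert Lu.
apply/subsetP => _ /imsetP[x /bigcupP[v /setIdP[Lv uv] xv] ->].
apply/bigcupP; exists (val f @: v); last exact: imset_f.
apply/setIdP; split; first exact: imset_line_vert Lv.
apply: (connect_homo_from (f := fun s : {set vert G} => val f @: s) _ uv).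
move=> a b _ /and4P[La Lb ab kab]; apply/and4P; split.
- exact: imset_line_vert La.
- exact: imset_line_vert Lb.
(* Injectivity of [f] keeps distinct sets distinct and makes images commute with intersections
   without changing their size. *)
- by apply: contra_neq ab => /(imset_inj (@ghom_inj _ _ f)).
- by rewrite -imsetI ?card_imset //; [exact: ghom_inj|move=> ? ? _ _; exact: ghom_inj].
Qed.

Section Restriction.
Variables (G : hypergraph) (p : {set vert G}).

Lemma imset_val_preim (u : {set vert G}) : u \subset p ->
  val @: [set x : vert (restrict p) | val x \in u] = u.
Proof.
move=> /subsetP up; apply/setP => x; apply/imsetP/idP => [[y]|xu].
  by rewrite inE => yu ->.
by exists (exist _ x (up _ xu)); rewrite ?inE.
Qed.

Lemma is_ghom_restrict_incl :
  is_ghom ([ffun x => val x] : {ffun vert (restrict p) -> vert G}).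
Proof.
apply/andP; split; first by apply/injectiveP => x y; rewrite !ffunE => /val_inj.
apply/forallP => e; apply/existsP; exists (val e); apply/eqP.
rewrite -[RHS](imset_val_preim (valP e)).
by apply: eq_imset => x; rewrite ffunE.
Qed.

Definition restrict_incl : ghom (restrict p) G :=
  exist _ [ffun x => val x] is_ghom_restrict_incl.

Lemma imset_restrict_incl (A : {set vert (restrict p)}) :
  val restrict_incl @: A = val @: A.
Proof. by apply: eq_imset => x; rewrite ffunE. Qed.

(** An edge of [G] that is the image of an edge of [R] lies in the image of [w], hence in [p], so it
    survives in the restriction. *)
Lemma ghom_corestrict (R : hypergraph) (w : ghom R G) :
  val w @: [set: vert R] \subset p ->
  exists w' : ghom R (restrict p), forall x, val (val w' x) = val w x.
Proof.
move=> /subsetP wp.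
have wpx x : val w x \in p by apply: wp; apply: imset_f.
pose f : {ffun vert R -> vert (restrict p)} :=
  [ffun x => exist (fun y => y \in p) (val w x) (wpx x)].
have fE x : val (f x) = val w x by rewrite ffunE.
suff fP : is_ghom f by exists (exist _ f fP).
apply/andP; split.
  by apply/injectiveP => x y fxy; apply: (@ghom_inj _ _ w); rewrite -!fE fxy.
have /andP[_ /forallP wE] := valP w.
apply/forallP => e; have /existsP[e' /eqP we] := wE e; apply/existsP.
have e'p : eps e' \subset p.
  by rewrite -we; apply/subsetP => _ /imsetP[x _ ->].
(* Edges of the restriction are preimages under the injection [val], so they are compared after
   being pushed forward to [G]. *)
exists (exist _ e' e'p); apply/eqP/(imset_inj val_inj).
rewrite [RHS](imset_val_preim e'p) -we -imset_comp.
by apply: eq_imset => x; exact: fE.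
Qed.

Lemma preim_line_vert (RR : hypergraph -> Prop) (u : {set vert G}) :
  u \in line_vert (Phi RR G) -> u \subset p ->
  [set x : vert (restrict p) | val x \in u] \in line_vert (Phi RR (restrict p)).
Proof.
case/line_vert_PhiP => R [RRR [w uE]] up.
have [|w' w'E] := @ghom_corestrict R w; first by rewrite -uE.
apply/line_vert_PhiP; exists R; split=> //; exists w'.
apply: (imset_inj val_inj); rewrite imset_val_preim // uE -imset_comp.
by apply: eq_imset => x; rewrite /= w'E.
Qed.

End Restriction.

Lemma repr_scheme_excisive (RR : hypergraph -> Prop) (k : option nat) :
  excisive (repr_scheme RR k).
Proof.
move=> G p /repr_schemeP[u Lu pE].
have sub v : v \in line_vert (Phi RR G) ->
    connect (@line_adj k (Phi RR G)) u v -> v \subset p.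
  by move=> Lv uv; rewrite pE; apply: (bigcup_max v); rewrite //; apply/setIdP.
pose g (v : {set vert G}) := [set x : vert (restrict p) | val x \in v].
apply/repr_schemeP; exists (g u).
  by apply: preim_line_vert => //; exact: sub (connect0 _ _).
(* It suffices to cover each [x] of the restriction by the trace of a member of the component of
   [u]. *)
apply/esym/eqP; rewrite -subTset; apply/subsetP => x _.
(* The type of [x] depends on [p], so only the membership of [val x] is transported along [pE]. *)
have /bigcupP[v /setIdP[Lv uv] xv] := eq_ind p (fun q : {set vert G} => val x \in q) (valP x) _ pE.
apply/bigcupP; exists (g v); last by rewrite inE.
apply/setIdP; split; first exact: preim_line_vert Lv (sub _ Lv uv).
apply: (connect_homo_from (f := g) _ uv) => a b ua ab.
have ub := connect_trans ua (connect1 ab).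
have /and4P[La Lb nab kab] := ab.
have [ap bp] := (sub a La ua, sub b Lb ub).
apply/and4P; split; [exact: preim_line_vert|exact: preim_line_vert| |].
  (* On subsets of [p], the map [g] is injective: the image under [val] inverts it. *)
  apply: contra_neq nab => gab.
  by rewrite -(imset_val_preim ap) -(imset_val_preim bp) -/(g a) gab.
rewrite -(card_imset _ val_inj) imsetI; last by move=> ? ? _ _; exact: val_inj.
by rewrite !imset_val_preim.
Qed.

(** For infinite [k] the line graph has no edges, so each component is a singleton and its union is
    its only member. *)
Lemma repr_scheme_infinityE (RR : hypergraph -> Prop) (G : hypergraph) :
  repr_scheme RR None G = line_vert (Phi RR G).
Proof.
have compE u : u \in line_vert (Phi RR G) ->
    cover [set v in line_vert (Phi RR G)
            | connect (@line_adj None (Phi RR G)) u v] = u.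
  move=> Lu; rewrite -[RHS]cover1; congr cover; apply/setP => v.
  apply/setIdP/set1P => [[_]|-> //].
  case/connectP => -[|x s] /=; first by [].
  by rewrite /line_adj /= !andbF.
apply/setP => p; apply/repr_schemeP/idP => [[u Lu ->]|Lp]; first by rewrite compE.
by exists p; rewrite ?compE.
Qed.

(** The two halves of refinement make the identity map a morphism in both directions; naturality
    holds because both functors keep the underlying functions. *)
Lemma refines_naturally_isomorphic (c c' : clustering_scheme)
    (fc : functorial c) (fc' : functorial c') :
  refines c' c ->
  naturally_isomorphic (scheme_functor fc) (scheme_functor fc').
Proof.
move=> ref.
have toP G : @is_phom (scheme_obj c G) (scheme_obj c' G) [ffun x => x].
  apply/forall_inP => p cp; apply/exists_inP; exists p.
    exact: (subsetP (ref G).2).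
  by apply/subsetP => _ /imsetP[y yp ->]; rewrite ffunE.
have ofP G : @is_phom (scheme_obj c' G) (scheme_obj c G) [ffun x => x].
  apply/forall_inP => p cp; apply/exists_inP.
  have [q cq /subsetP pq] := (ref G).1 p cp; exists q => //.
  by apply/subsetP => _ /imsetP[y yp ->]; rewrite ffunE; exact: pq.
exists (fun G => exist _ [ffun x => x] (toP G)); split=> [G H f|G].
  by apply: val_inj; apply/ffunP => x; rewrite !ffunE.
exists (exist _ [ffun x => x] (ofP G)).
by split; apply: val_inj; apply/ffunP => x; rewrite !ffunE.
Qed.

Lemma representable_refinement (c : clustering_scheme) :
  excisive c -> functorial c ->
  refines (repr_scheme (fun R => [set: vert R] \in c R) None) c.
Proof.
move=> ec fc G; rewrite repr_scheme_infinityE; split=> [p|].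
  case/line_vert_PhiP => R [cR [w ->]].
  by have /forall_inP/(_ _ cR)/exists_inP[q] := fc R G w; exists q.
apply/subsetP => p cp; apply/line_vert_PhiP.
exists (restrict p); split; first exact: ec.
exists (restrict_incl p); rewrite imset_restrict_incl.
(* Writes [p] as the image of its own preimage, which is the whole vertex set of the restriction. *)
rewrite -[LHS](imset_val_preim (subxx p)).
suff -> : [set x : vert (restrict p) | val x \in p] = setT by [].
by apply/setP => x; rewrite !inE (valP x).
Qed.

Theorem mainTheorem7 :
  (forall c : clustering_scheme,
     representable c -> excisive c /\ functorial c) /\
  (forall (c : clustering_scheme) (ec : excisive c) (fc : functorial c),
     exists c' : clustering_scheme,
       representable c' /\
       refines c' c /\
       exists fc' : functorial c',
         naturally_isomorphic (scheme_functor fc) (scheme_functor fc')).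
Proof.
split=> [c [RR [k [_ cE]]]|c ec fc].
  split=> [G p|G H f]; rewrite /scheme_obj !cE.
    exact: repr_scheme_excisive.
  exact: repr_scheme_functorial.
have ref := representable_refinement ec fc.
exists (repr_scheme (fun R => [set: vert R] \in c R) None).
split; first by eexists; exists None.
split=> //; exists (@repr_scheme_functorial _ _).
exact: refines_naturally_isomorphic.
Qed.
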